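(* Consider the $6$-dimensional Wallach flag manifold $\mathrm{SU}(3)/\mathrm{T}^2$. For every $d\in\{1,\ldots,6\}$ the set $\mathcal{R}^{\mathrm{Ric\text{-}scal}}_d$ is non-empty. Moreover, for each $d\in\{1,\ldots,6\}$: (a) there exist an invariant Riemannian metric $g=(x_0,y_0)\in\mathcal{R}^{\mathrm{Ric\text{-}scal}}_d$ and $t^*\in\mathbb{R}$ such that the projected homogeneous Ricci flow $g(t)=(x(t),y(t))$ with initial condition $g(0)=g$ satisfies $g(t)\in\mathcal{R}^{\mathrm{Ric\text{-}scal}}_d$ for all sufficiently small $t$, and $g(t)\notin\mathcal{R}^{\mathrm{Ric\text{-}scal}}_d$ for every $t$ in a neighborhood of $t^*$; (b) there exists a (non-empty) open region $\mathcal{R}\subsetneq\mathcal{R}^{\mathrm{Ric\text{-}scal}}_d$ such that for every $g=(x_0,y_0)\in\mathcal{R}$ the projected homogeneous Ricci flow $g(t)$ with initial condition $g(0)=g$ lies in $\mathcal{R}$ for every $t\in\mathbb{R}$.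
   Context: Invariant metrics. $\mathrm{T}^2\subset\mathrm{SU}(3)$ is the maximal torus of diagonal matrices. For $1\le j<k\le 3$ let $\mathrm{A}_{jk}$ be the antisymmetric $3\times3$ matrix with entry $1$ in position $kj$, $-1$ in position $jk$ and $0$ elsewhere, and let $\mathrm{S}_{jk}$ be the symmetric $3\times 3$ matrix with entry $\mathrm{i}=\sqrt{-1}$ in positions $jk$ and $kj$ and $0$ elsewhere. The tangent space of $\mathrm{SU}(3)/\mathrm{T}^2$ at the base point is identified with $\mathfrak m=\mathfrak m_{12}\oplus\mathfrak m_{13}\oplus\mathfrak m_{23}$, $\mathfrak m_{jk}=\mathrm{span}_{\mathbb{R}}\{\frac12\mathrm{A}_{jk},\frac12\mathrm{S}_{jk}\}$, the decomposition into irreducible pairwise non-equivalent isotropy representations. Every $\mathrm{SU}(3)$-invariant Riemannian metric is determined by positive numbers $(x,y,z)$: the six vectors $\frac12\mathrm{A}_{jk},\frac12\mathrm{S}_{jk}$ are mutually orthogonal and $g(\frac12\mathrm{A}_{12},\frac12\mathrm{A}_{12})=g(\frac12\mathrm{S}_{12},\frac12\mathrm{S}_{12})=x$, $g(\frac12\mathrm{A}_{13},\frac12\mathrm{A}_{13})=g(\frac12\mathrm{S}_{13},\frac12\mathrm{S}_{13})=y$, $g(\frac12\mathrm{A}_{23},\frac12\mathrm{A}_{23})=g(\frac12\mathrm{S}_{23},\frac12\mathrm{S}_{23})=z$. It is always assumed that $x+y+z=1$, and the metric $(x,y,1-x-y)$ is denoted by $(x,y)$; thus invariant metrics are identified with points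 $(x,y)\in\mathbb{R}^2$ with $x>0$, $y>0$, $x+y<1$. Curvature condition. Let $(M,g)$ be an $n$-dimensional Riemannian manifold and $d\in\{1,\ldots,n\}$. Denote by $\lambda_1,\ldots,\lambda_l$ the distinct eigenvalues of the Ricci tensor $\mathrm{Ric}(g)$ (with respect to $g$) and by $\mu(\lambda_j)$ the multiplicity of $\lambda_j$. The metric $g$ has positive $d$-curvature if $\sum_{j=1}^l a_j\lambda_j>0$ for every collection of non-negative integers $(a_1,\ldots,a_l)$ with $a_1+\cdots+a_l=d$ and $0\le a_j\le\mu(\lambda_j)$ for all $j$. $\mathcal{R}^{\mathrm{Ric\text{-}scal}}_d$ denotes the set of Riemannian metrics with positive $d$-curvature; on $\mathrm{SU}(3)/\mathrm{T}^2$ it is considered among invariant metrics, hence as a set of points $(x,y)$ in the plane. Projected homogeneous Ricci flow. This is the flow of the planar system $x'=u(x,y)$, $y'=v(x,y)$ on the triangle $\{x\ge0,\ y\ge0,\ x+y\le1\}$, where $u(x,y)=2x\left(x^2(2-12y)-3x(4y^2-6y+1)+6y^2-6y+1\right)$ and $v(x,y)=-2y(2y-1)\left(6x^2+6x(y-1)-y+1\right)$ (obtained from the homogeneous Ricci flow by a time reparametrization and projection to $x+y+z=1$). *)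

(* Defs.v *)
From HB Require Import structures.
From mathcomp Require Import all_boot all_order all_algebra.
From mathcomp Require Import complex.
From mathcomp Require Import all_classical all_reals all_analysis.

Set Implicit Arguments.
Unset Strict Implicit.
Unset Printing Implicit Defensive.

Import Order.TTheory GRing.Theory Num.Theory.
Import numFieldNormedType.Exports.

Local Open Scope classical_set_scope.
Local Open Scope complex_scope.
Local Open Scope ring_scope.

Section IsotropyModule.
Variable R : realType.

Definition antisym_mx (j k : 'I_3) : 'M[R[i]]_3 :=
  delta_mx k j - delta_mx j k.

Definition sym_mx (j k : 'I_3) : 'M[R[i]]_3 :=
  'i *: (delta_mx j k + delta_mx k j).

(* The indices 1, 2, 3 of C^3 are ord0, 1, ord_max : 'I_3.  The basis of m is
   ordered A_12/2, S_12/2, A_13/2, S_13/2, A_23/2, S_23/2. *)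
Definition m_basis (a : 'I_6) : 'M[R[i]]_3 :=
  2^-1 *: nth 0 [:: antisym_mx ord0 1; sym_mx ord0 1;
                    antisym_mx ord0 ord_max; sym_mx ord0 ord_max;
                    antisym_mx 1 ord_max; sym_mx 1 ord_max] a.

(* Vectors of m are handled through their coordinates in m_basis. *)
Definition m_mx (v : 'rV[R]_6) : 'M[R[i]]_3 :=
  \sum_a (v 0 a)%:C *: m_basis a.

(* Coordinates of the m-component of X in su(3) = Lie(T^2) + m: the entry
   (k, j), j < k, of the matrix a A_jk/2 + b S_jk/2 is (a + i b)/2. *)
Definition m_coord (X : 'M[R[i]]_3) : 'rV[R]_6 :=
  \row_a (2 * nth 0 [:: complex.Re (X 1 ord0); complex.Im (X 1 ord0);
                        complex.Re (X ord_max ord0); complex.Im (X ord_max ord0);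
                        complex.Re (X ord_max 1); complex.Im (X ord_max 1)] a).

Definition h_part (X : 'M[R[i]]_3) : 'M[R[i]]_3 :=
  \matrix_(j, k) (X j k *+ (j == k)).

Definition lie (X Y : 'M[R[i]]_3) : 'M[R[i]]_3 := X *m Y - Y *m X.

Definition lie_m (u v : 'rV[R]_6) : 'rV[R]_6 := m_coord (lie (m_mx u) (m_mx v)).

Definition lie_h (u v : 'rV[R]_6) : 'M[R[i]]_3 := h_part (lie (m_mx u) (m_mx v)).

End IsotropyModule.

(* Curvature at the base point of the SU(3)-invariant metric (x, y, z), from the
   Levi-Civita connection of a reductive homogeneous space (Kobayashi-Nomizu,
   Foundations of Differential Geometry II, Theorems X.2.3 and X.3.3). *)
Section InvariantMetric.
Variables (R : realType) (x y z : R).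

Local Notation e := (delta_mx 0).

Definition weight (a : 'I_6) : R := nth 0 [:: x; x; y; y; z; z] a.

Definition metric (u v : 'rV[R]_6) : R := \sum_a weight a * u 0 a * v 0 a.

(* 2 g(U(u, v), w) = g([w, u]_m, v) + g(u, [w, v]_m) for all w in m. *)
Definition nomizu_U (u v : 'rV[R]_6) : 'rV[R]_6 :=
  \row_a ((metric (lie_m (e a) u) v + metric u (lie_m (e a) v))
          / (2 * weight a)).

Definition levi_civita (u v : 'rV[R]_6) : 'rV[R]_6 :=
  2^-1 *: lie_m u v + nomizu_U u v.

(* R(u, v) w *)
Definition curvature (u v w : 'rV[R]_6) : 'rV[R]_6 :=
  levi_civita u (levi_civita v w) - levi_civita v (levi_civita u w)
  - levi_civita (lie_m u v) w - m_coord (lie (lie_h u v) (m_mx w)).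

(* Ric(v, w) is the trace of u |-> R(u, v) w. *)
Definition ricci (v w : 'rV[R]_6) : R := \sum_a curvature (e a) v w 0 a.

(* The endomorphism v |-> v *m ricci_op of m satisfies
   g(v *m ricci_op, w) = Ric(v, w); its eigenvalues are those of Ric with
   respect to g. *)
Definition ricci_op : 'M[R]_6 :=
  \matrix_(a, b) (ricci (e a) (e b) / weight b).

End InvariantMetric.

(* lam 0, ..., lam (l - 1) are the distinct eigenvalues of M, the Ricci
   endomorphism. *)
Definition positive_d_curvature (R : realType) (n d : nat) (M : 'M[R]_n) : Prop :=
  forall (l : nat) (lam : 'I_l -> R) (a : 'I_l -> nat),
    injective lam ->
    (forall c, eigenvalue M c <-> exists j, c = lam j) ->
    (\sum_j a j)%N = d ->
    (forall j, (a j <= \rank (eigenspace M (lam j)))%N) ->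
    0 < \sum_j (a j)%:R * lam j.

Definition invariant_metrics (R : realType) : set (R * R) :=
  [set p | 0 < p.1 /\ 0 < p.2 /\ p.1 + p.2 < 1].

(* An invariant metric is homogeneous, so that its d-curvature is positive if and
   only if it is positive at the base point. *)
Definition ric_scal (R : realType) (d : nat) : set (R * R) :=
  [set p | invariant_metrics p /\
           positive_d_curvature d (ricci_op p.1 p.2 (1 - p.1 - p.2))].

Section ProjectedFlow.
Variable R : realType.

Definition field_u (x y : R) : R :=
  2 * x * (x ^+ 2 * (2 - 12 * y) - 3 * x * (4 * y ^+ 2 - 6 * y + 1)
           + 6 * y ^+ 2 - 6 * y + 1).

Definition field_v (x y : R) : R :=
  - 2 * y * (2 * y - 1) * (6 * x ^+ 2 + 6 * x * (y - 1) - y + 1).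

Definition triangle : set (R * R) :=
  [set p | 0 <= p.1 /\ 0 <= p.2 /\ p.1 + p.2 <= 1].

(* phi t p is the value at time t of the trajectory with initial condition p. *)
Definition is_projected_ricci_flow (phi : R -> R * R -> R * R) : Prop :=
  forall p, triangle p ->
    phi 0 p = p /\
    forall t, triangle (phi t p) /\
      is_derive t 1 (fun s => (phi s p).1) (field_u (phi t p).1 (phi t p).2) /\
      is_derive t 1 (fun s => (phi s p).2) (field_v (phi t p).1 (phi t p).2).

End ProjectedFlow.

(* Main.v *)
Require Import Defs.
From HB Require Import structures.
From mathcomp Require Import all_boot all_order all_algebra.
From mathcomp Require Import complex zify ring lra.
From mathcomp Require Import all_classical all_reals all_analysis.

(* In the basis of m the Ricci operator of (x, y, z) is diagonal, with the double
   eigenvalue (6yz + x^2 - y^2 - z^2) / (4xyz) and its two permutations.  The open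
   medial triangle x, y, z < 1/2 is invariant under the flow, because each of
   w = 1/2 - x, 1/2 - y, 1/2 - z satisfies |w'| <= K |w| and so cannot reach 0 in
   finite time; there x, y, z satisfy the strict triangle inequalities, which makes
   all Ricci eigenvalues positive.  This gives (b) for all d at once.  For (a), the
   same estimate shows that the diagonal x = y is invariant; the flow on it is
   x' = 2x(1-2x)(1-3x)(1-4x), so the trajectory of (1/5, 1/5), where Ric > 0,
   tends to (0, 0) backwards in time, and near (0, 0) the scalar curvature is
   negative, hence the sum of the d lowest Ricci eigenvalues is negative for
   every d.

   The flow itself is obtained from Picard's theorem applied to the field composed
   with the clamping of both coordinates to [0, 1], which is globally Lipschitz. *)

Set Implicit Arguments.
Unset Strict Implicit.
Unset Printing Implicit Defensive.

Import Order.TTheory GRing.Theory Num.Theory.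
Import numFieldNormedType.Exports.

Local Open Scope classical_set_scope.
Local Open Scope ring_scope.

(** * The Ricci operator *)

Section Ricci.
Variable R : realType.
Local Open Scope complex_scope.

Definition row6 (a b c d e f : R) : 'rV[R]_6 :=
  \row_i nth 0 [:: a; b; c; d; e; f] i.

Definition mx3 {T : nzRingType} (a b c d e f g h k : T) : 'M[T]_3 :=
  \matrix_(i, j) nth 0 (nth [::] [:: [:: a; b; c]; [:: d; e; f]; [:: g; h; k]] i) j.

Lemma m_mxE a b c d e f :
  m_mx (row6 a b c d e f) =
  mx3 0 ((- a / 2) +i* (b / 2)) ((- c / 2) +i* (d / 2))
    ((a / 2) +i* (b / 2)) 0 ((- e / 2) +i* (f / 2))
    ((c / 2) +i* (d / 2)) ((e / 2) +i* (f / 2)) 0.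
Proof.
have E : (2^-1 : R[i]) = (2^-1)%:C by rewrite fmorphV rmorph_nat.
rewrite /m_mx !big_ord_recl big_ord0 /m_basis E.
apply/matrixP => -[[|[|[|//]]] ?] -[[|[|[|//]]] ?];
  rewrite !mxE /= ?(mulr0n, mulr1n, subr0, sub0r, addr0, oppr0, mulr0, add0r);
  simpc => //; congr (_ +i* _); field.
Qed.

Lemma mx3_lie {T : nzRingType} (a b c d e f g h k a' b' c' d' e' f' g' h' k' : T) :
  let A := mx3 a b c d e f g h k in
  let B := mx3 a' b' c' d' e' f' g' h' k' in
  A *m B - B *m A =
  mx3 (a * a' + b * d' + c * g' - (a' * a + b' * d + c' * g))
      (a * b' + b * e' + c * h' - (a' * b + b' * e + c' * h))
      (a * c' + b * f' + c * k' - (a' * c + b' * f + c' * k))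
      (d * a' + e * d' + f * g' - (d' * a + e' * d + f' * g))
      (d * b' + e * e' + f * h' - (d' * b + e' * e + f' * h))
      (d * c' + e * f' + f * k' - (d' * c + e' * f + f' * k))
      (g * a' + h * d' + k * g' - (g' * a + h' * d + k' * g))
      (g * b' + h * e' + k * h' - (g' * b + h' * e + k' * h))
      (g * c' + h * f' + k * k' - (g' * c + h' * f + k' * k)).
Proof.
move=> A B; apply/matrixP => -[[|[|[|//]]] ?] -[[|[|[|//]]] ?];
  by rewrite !mxE !big_ord_recl !big_ord0 !mxE /= !addrA !addr0.
Qed.

(** Bracketing two different blocks [m_jk] lands in the third, and a block bracketed with itself has
    no part in m; so each output pair mixes only the other two pairs. *)
Lemma lie_mE a b c d e f a' b' c' d' e' f' :
  lie_m (row6 a b c d e f) (row6 a' b' c' d' e' f') =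
  row6 ((c * e' + d * f' - (c' * e + d' * f)) / 2)
    ((d * e' - c * f' - (d' * e - c' * f)) / 2)
    ((e * a' - f * b' - (e' * a - f' * b)) / 2)
    ((e * b' + f * a' - (e' * b + f' * a)) / 2)
    ((a * c' + b * d' - (a' * c + b' * d)) / 2)
    ((a * d' - b * c' - (a' * d - b' * c)) / 2).
Proof.
apply/rowP => -[[|[|[|[|[|[|//]]]]]] ?];
  rewrite mxE [RHS]mxE /lie !m_mxE mx3_lie !mxE /=;
  simpc => /=; by field.
Qed.

(** Only brackets inside a single block reach the torus; [h1], [h2], [h3] are the contributions of
    the three blocks. *)
Lemma lie_hE a b c d e f a' b' c' d' e' f' :
  let h1 := (a * b' - b * a') / 2 in
  let h2 := (c * d' - d * c') / 2 in
  let h3 := (e * f' - f * e') / 2 in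
  lie_h (row6 a b c d e f) (row6 a' b' c' d' e' f') =
  mx3 (0 +i* (- h1 - h2)) 0 0 0 (0 +i* (h1 - h3)) 0 0 0 (0 +i* (h2 + h3)).
Proof.
move=> h1 h2 h3; rewrite /lie_h /lie !m_mxE.
apply/matrixP => -[[|[|[|//]]] ?] -[[|[|[|//]]] ?];
  rewrite mxE [RHS]mxE mx3_lie mxE /= ?mulr0n ?mulr1n //; simpc;
  congr (_ +i* _); rewrite /h1 /h2 /h3; by field.
Qed.

(** The torus acts on each block as an infinitesimal rotation whose speed is a difference of two
    diagonal entries. *)
Lemma m_coord_lie_diag (h1 h2 h3 : R) a b c d e f :
  m_coord (lie (mx3 (0 +i* h1) 0 0 0 (0 +i* h2) 0 0 0 (0 +i* h3))
                (m_mx (row6 a b c d e f))) =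
  row6 (- (h2 - h1) * b) ((h2 - h1) * a) (- (h3 - h1) * d) ((h3 - h1) * c)
       (- (h3 - h2) * f) ((h3 - h2) * e).
Proof.
apply/rowP => -[[|[|[|[|[|[|//]]]]]] ?];
  rewrite mxE [RHS]mxE /lie !m_mxE mx3_lie !mxE /=;
  simpc => /=; by field.
Qed.

Lemma delta_row6 (i : 'I_6) :
  delta_mx 0 i = row6 (0 == i :> nat)%:R (1%N == i :> nat)%:R (2%N == i :> nat)%:R
    (3%N == i :> nat)%:R (4%N == i :> nat)%:R (5%N == i :> nat)%:R.
Proof.
apply/rowP => -[[|[|[|[|[|[|//]]]]]] ?]; by rewrite !mxE.
Qed.

Section Metric.
Variables x y z : R.
Hypotheses (x0 : x != 0) (y0 : y != 0) (z0 : z != 0).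

Lemma metricE a b c d e f a' b' c' d' e' f' :
  metric x y z (row6 a b c d e f) (row6 a' b' c' d' e' f') =
  x * (a * a' + b * b') + y * (c * c' + d * d') + z * (e * e' + f * f').
Proof. by rewrite /metric !big_ord_recl big_ord0 !mxE /weight /=; ring. Qed.

(** Connection coefficients: in the i-th block, [p] goes with arguments from the other two blocks in
    cyclic order and [q] with the reverse order. That [p] and [q] of a block add up to 1/2 expresses
    the absence of torsion. *)
Let p1 := (x - y + z) / (4 * x).
Let q1 := (x + y - z) / (4 * x).
Let p2 := (x + y - z) / (4 * y).
Let q2 := (y + z - x) / (4 * y).
Let p3 := (y + z - x) / (4 * z).
Let q3 := (x - y + z) / (4 * z).

Lemma levi_civitaE a b c d e f a' b' c' d' e' f' :
  levi_civita x y z (row6 a b c d e f) (row6 a' b' c' d' e' f') =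
  row6 (p1 * (c * e' + d * f') - q1 * (c' * e + d' * f))
    (p1 * (d * e' - c * f') - q1 * (d' * e - c' * f))
    (p2 * (e * a' - f * b') - q2 * (e' * a - f' * b))
    (p2 * (e * b' + f * a') - q2 * (e' * b + f' * a))
    (p3 * (a * c' + b * d') - q3 * (a' * c + b' * d))
    (p3 * (a * d' - b * c') - q3 * (a' * d - b' * c)).
Proof.
apply/rowP => -[[|[|[|[|[|[|//]]]]]] ?];
  rewrite /levi_civita !lie_mE mxE mxE mxE mxE [RHS]mxE delta_row6 /weight /=
    !lie_mE !metricE /p1 /q1 /p2 /q2 /p3 /q3; by field; rewrite ?x0 ?y0 ?z0.
Qed.

(** These are the summands of the Ricci trace. In [kij] the traced direction lies in block i and the
    arguments in block j; it comes from the connection. Inside one block only the torus term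
    survives, with coefficient 1. *)
Lemma curvature_diagE a b c d e f a' b' c' d' e' f' (k : 'I_6) :
  let k12 := q1 / 2 - p1 * p3 in let k13 := p1 / 2 - q1 * q2 in
  let k21 := p2 / 2 - q2 * q3 in let k23 := q2 / 2 - p1 * p2 in
  let k31 := q3 / 2 - p2 * p3 in let k32 := p3 / 2 - q1 * q3 in
  curvature x y z (delta_mx 0 k) (row6 a b c d e f) (row6 a' b' c' d' e' f') 0 k =
  nth 0 [:: b * b' + k12 * (c * c' + d * d') + k13 * (e * e' + f * f');
            a * a' + k12 * (c * c' + d * d') + k13 * (e * e' + f * f');
            d * d' + k21 * (a * a' + b * b') + k23 * (e * e' + f * f');
            c * c' + k21 * (a * a' + b * b') + k23 * (e * e' + f * f');
            f * f' + k31 * (a * a' + b * b') + k32 * (c * c' + d * d');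
            e * e' + k31 * (a * a' + b * b') + k32 * (c * c' + d * d')] k.
Proof.
move=> k12 k13 k21 k23 k31 k32; rewrite delta_row6 /curvature.
rewrite /k12 /k13 /k21 /k23 /k31 /k32.
by case: k => -[|[|[|[|[|[|//]]]]]] ? /=;
  rewrite !levi_civitaE lie_mE lie_hE m_coord_lie_diag !levi_civitaE !mxE /=
    ?(mulr0, mulr1, mul0r, mul1r, subr0, sub0r, addr0, add0r, oppr0); field.
Qed.

Lemma ricciE a b c d e f a' b' c' d' e' f' :
  ricci x y z (row6 a b c d e f) (row6 a' b' c' d' e' f') =
  (6 * y * z + x ^+ 2 - y ^+ 2 - z ^+ 2) / (4 * y * z) * (a * a' + b * b') +
  (6 * x * z + y ^+ 2 - x ^+ 2 - z ^+ 2) / (4 * x * z) * (c * c' + d * d') +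
  (6 * x * y + z ^+ 2 - x ^+ 2 - y ^+ 2) / (4 * x * y) * (e * e' + f * f').
Proof.
(* Each coefficient is 1 from the torus plus the [kij] of the other two blocks, doubled because
   every block is two-dimensional. *)
have -> : (6 * y * z + x ^+ 2 - y ^+ 2 - z ^+ 2) / (4 * y * z) =
    1 + 2 * (p2 / 2 - q2 * q3) + 2 * (q3 / 2 - p2 * p3).
  by rewrite /p2 /p3 /q2 /q3; field; rewrite y0 z0.
have -> : (6 * x * z + y ^+ 2 - x ^+ 2 - z ^+ 2) / (4 * x * z) =
    1 + 2 * (q1 / 2 - p1 * p3) + 2 * (p3 / 2 - q1 * q3).
  by rewrite /p1 /p3 /q1 /q3; field; rewrite x0 z0.
have -> : (6 * x * y + z ^+ 2 - x ^+ 2 - y ^+ 2) / (4 * x * y) =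
    1 + 2 * (p1 / 2 - q1 * q2) + 2 * (q2 / 2 - p1 * p2).
  by rewrite /p1 /p2 /q1 /q2; field; rewrite x0 y0.
rewrite /ricci (eq_bigr _ (fun k _ => curvature_diagE a b c d e f a' b' c' d' e' f' k)).
by rewrite !big_ord_recl big_ord0 /=; ring.
Qed.

End Metric.
End Ricci.

(** * Positive d-curvature of diagonal operators *)

Lemma eigenvalue_diag_mx (F : fieldType) n (D : 'rV[F]_n) c :
  eigenvalue (diag_mx D) c -> exists i, c = D 0 i.
Proof.
move=> /eigenvalueP[v vD /rV0Pn[i vi0]]; exists i.
move/rowP: vD => /(_ i); rewrite mul_mx_diag !mxE mulrC => /(mulIf vi0).
by move->.
Qed.

Lemma rank_diag_mx_le (F : fieldType) n (D : 'rV[F]_n) :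
  (\rank (diag_mx D) <= #|[pred i | (D 0 i != 0)%R]|)%N.
Proof.
rewrite diag_mx_sum_delta -sum1_card [leqRHS]big_mkcond /=.
elim/big_ind2: _ => [|m A p B mA pB|i _]; first by rewrite mxrank0.
  by rewrite (leq_trans (mxrank_add _ _))// leq_add.
rewrite inE; have [->|_] := eqVneq (D 0 i) 0; first by rewrite scale0r mxrank0.
by rewrite (leq_trans (mxrank_scale _ _))// mxrank_delta.
Qed.

(** The eigenspace is the kernel of the diagonal matrix minus [a], whose rank is at most the number
    of entries different from [a]. *)
Lemma rank_eigenspace_diag_mx_ge (F : fieldType) n (D : 'rV[F]_n) a :
  (#|[pred i | (D 0 i == a)%R]| <= \rank (eigenspace (diag_mx D) a))%N.
Proof.
rewrite mxrank_ker -diag_const_mx -raddfB /=.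
apply: (leq_trans _ (leq_sub2l n (rank_diag_mx_le (D - const_mx a)))).
rewrite [X in (n - X)%N](eq_card (B := [predC [pred i | D 0 i == a]])).
  by rewrite -[X in (X - _)%N](card_ord n) -(cardC [pred i | D 0 i == a]) addnK.
by move=> i; rewrite !inE !mxE subr_eq0.
Qed.

Lemma positive_d_curvature_diag (R : realType) n d (D : 'rV[R]_n) :
  (0 < d)%N -> (forall i, 0 < D 0 i) -> positive_d_curvature d (diag_mx D).
Proof.
move=> d0 Dpos l lam a _ lamP ad _.
have lam0 j : 0 < lam j.
  have /eigenvalue_diag_mx[i ->] : eigenvalue (diag_mx D) (lam j).
    by apply/lamP; exists j.
  exact: Dpos.
(* As [d > 0], some weight is positive, which makes the sum strict. *)
have [j aj0] : exists j, (0 < a j)%N.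
  apply/existsP; rewrite -[X in is_true X]negbK; apply/negP => /existsPn a0.
  by move: d0; rewrite -ad big1 // => j _; apply/eqP; rewrite -leqn0 leqNgt a0.
rewrite (bigD1 j) //= ltr_pwDl ?mulr_gt0 ?ltr0n //.
by apply: sumr_ge0 => k _; rewrite mulr_ge0 // ltW.
Qed.

(** The first argument is the parameter of the block on which this is the eigenvalue; the formula is
    symmetric in the other two. *)
Definition ricci_eig (R : realType) (x y z : R) : R :=
  (6 * y * z + x ^+ 2 - y ^+ 2 - z ^+ 2) / (4 * x * y * z).

Definition ricci_eigs (R : realType) (x y z : R) : 'rV[R]_6 :=
  let r1 := ricci_eig x y z in
  let r2 := ricci_eig y x z in
  let r3 := ricci_eig z x y in
  row6 r1 r1 r2 r2 r3 r3.

Lemma ricci_eigs_gt0 (R : realType) (x y z : R) i :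
  0 < x -> 0 < y -> 0 < z ->
  y ^+ 2 + z ^+ 2 < 6 * y * z + x ^+ 2 ->
  x ^+ 2 + z ^+ 2 < 6 * x * z + y ^+ 2 ->
  x ^+ 2 + y ^+ 2 < 6 * x * y + z ^+ 2 ->
  0 < ricci_eigs x y z 0 i.
Proof.
move=> x0 y0 z0 h1 h2 h3; rewrite mxE.
by case: i => -[|[|[|[|[|[|//]]]]]] ? /=; rewrite divr_gt0 ?mulr_gt0 //; lra.
Qed.

(** On the diagonal one eigenvalue has multiplicity 4 and is negative for z > 6 s, the other is
    double and positive. For z > 16 s one has 12 s z + 4 s^2 < z^2, so the trace is negative as
    well. *)
Lemma not_positive_d_curvature_ricci_eigs (R : realType) (s z : R) d : (1 <= d <= 6)%N ->
  0 < s -> 0 < z -> 16 * s < z ->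
  ~ positive_d_curvature d (diag_mx (ricci_eigs s s z)).
Proof.
move=> /andP[d1 d6] s0 z0 sz.
set D := ricci_eigs s s z.
have D1E : ricci_eig s s z = (6 * s - z) / (4 * s ^+ 2).
  by rewrite /ricci_eig; field; rewrite !gt_eqF.
have D3E : ricci_eig z s s = (4 * s ^+ 2 + z ^+ 2) / (4 * s ^+ 2 * z).
  by rewrite /ricci_eig; field; rewrite !gt_eqF.
have r1_lt0 : ricci_eig s s z < 0.
  by rewrite D1E pmulr_llt0 ?invr_gt0 ?mulr_gt0 ?exprn_gt0 //; lra.
have r3_gt0 : 0 < ricci_eig z s s.
  by rewrite D3E divr_gt0 ?mulr_gt0 ?exprn_gt0 // addr_gt0 ?mulr_gt0 ?exprn_gt0.
have tr_lt0 : 4 * ricci_eig s s z + 2 * ricci_eig z s s < 0.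
  have -> : 4 * ricci_eig s s z + 2 * ricci_eig z s s =
            (12 * s * z - z ^+ 2 + 4 * s ^+ 2) / (2 * s ^+ 2 * z).
    by rewrite D1E D3E; field; rewrite !gt_eqF.
  by rewrite pmulr_llt0 ?invr_gt0 ?mulr_gt0 ?exprn_gt0 //; nra.
pose lam (j : 'I_2) := if j == 0 then ricci_eig s s z else ricci_eig z s s.
(* The negative eigenvalue is used up first; truncated subtraction gives the positive one weight 0
   when [d <= 4]. *)
pose a (j : 'I_2) := if j == 0 then minn d 4 else (d - 4)%N.
move=> /(_ 2 lam a).
have lam_inj : injective lam.
  move=> -[[|[|//]] i1] -[[|[|//]] i2]; rewrite /lam /= => E; apply: val_inj => //=;
  by exfalso; move: r1_lt0 r3_gt0; rewrite ?E -?E; lra.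
have card0 : #|[pred i | D 0 i == ricci_eig s s z]| = 4%N.
  have D13 : (ricci_eig z s s == ricci_eig s s z) = false.
    by apply/negbTE; rewrite gt_eqF // (lt_trans r1_lt0).
  by rewrite -sum1_card big_mkcond /= !big_ord_recl big_ord0 !inE !mxE /= eqxx D13.
have card1 : (2 <= #|[pred i | (D 0 i == ricci_eig z s s)%R]|)%N.
  have D13 : (ricci_eig s s z == ricci_eig z s s) = false.
    by apply/negbTE; rewrite lt_eqF // (lt_trans r1_lt0).
  by rewrite -sum1_card big_mkcond /= !big_ord_recl big_ord0 !inE !mxE /= eqxx D13.
have lamD c : eigenvalue (diag_mx D) c <-> exists j, c = lam j.
  split.
    move=> /eigenvalue_diag_mx[i ->]; rewrite mxE.
    by case: i => -[|[|[|[|[|[|//]]]]]] ? /=; [exists 0..|exists 1|exists 1].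
  move=> [j ->]; rewrite /eigenvalue -mxrank_eq0 -lt0n.
  apply: (leq_trans _ (rank_eigenspace_diag_mx_ge _ _)).
  by rewrite /lam; case: ifP => _; rewrite ?card0 // ltnW.
move=> /(_ lam_inj lamD); rewrite !big_ord_recl !big_ord0 /a /lam /=.
have -> : (minn d 4 + (d - 4 + 0))%N = d by rewrite addn0; lia.
have mul_le (j : 'I_2) : (a j <= \rank (eigenspace (diag_mx D) (lam j)))%N.
  apply: leq_trans (rank_eigenspace_diag_mx_ge _ _).
  rewrite /a /lam; case: ifP => _; first by rewrite card0 geq_minr.
  by rewrite (leq_trans _ card1) // leq_subLR.
move=> /(_ erefl mul_le); apply/negP; rewrite -leNgt addr0.
have [d4|d4] := leqP d 4.
  rewrite (eqP (_ : (d - 4 == 0)%N)) ?subn_eq0 // mul0r addr0.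
  by rewrite mulr_ge0_le0 ?ler0n // ltW.
(* For [d > 4] the sum is at most the trace, negative by [tr_lt0]. *)
have : (d - 4)%:R * ricci_eig z s s <= 2 * ricci_eig z s s.
  by rewrite ler_wpM2r ?(ltW r3_gt0) // ler_nat leq_subLR.
lra.
Qed.

(** * Linear growth bounds and global solutions of Lipschitz systems *)

Section Derivative.
Variable R : realType.
Implicit Types f df w dw : R -> R.

Lemma is_derive_continuous f df :
  (forall t : R, is_derive t 1 f (df t)) -> continuous f.
Proof.
move=> fdf t; apply/differentiable_continuous/derivable1_diffP.
by have [] := fdf t.
Qed.

Lemma is_derive_ndecr f df (a b : R) :
  (forall t : R, is_derive t 1 f (df t)) -> a <= b ->
  (forall t, a <= t <= b -> 0 <= df t) -> f a <= f b.
Proof.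
move=> fdf ab df0.
have [c cab] := MVT_segment ab (fun x _ => fdf x)
  (continuous_subspaceT (is_derive_continuous fdf)).
rewrite -subr_ge0 => ->; rewrite mulr_ge0 ?subr_ge0 // df0 //.
Qed.

Lemma is_derive_expRM (k t : R) :
  is_derive t 1 (fun s => expR (k * s)) (k * expR (k * t)).
Proof.
have -> : (fun s => expR (k * s)) = expR \o (k \*: id) by apply/funext.
by apply: is_derive_eq; rewrite /= /GRing.scale /= mulr1 mulrC.
Qed.

Section LinearlyBounded.
Variables (w dw : R -> R) (K : R).
Hypothesis wdw : forall t : R, is_derive t 1 w (dw t).
Hypothesis dw_le : forall t, `|dw t| <= K * `|w t|.

Let dsq (k t : R) : is_derive t 1 (fun s => w s ^+ 2 * expR (k * s))
  ((2 * w t * dw t + k * w t ^+ 2) * expR (k * t)).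
Proof.
have -> : (fun s => w s ^+ 2 * expR (k * s)) =
          (w ^+ 2) * (fun s => expR (k * s)) by apply/funext.
have ek := is_derive_expRM k t.
apply: is_derive_eq; rewrite /= /GRing.scale /= expr1 exprfctE; ring.
Qed.

Let dsq_bound t : `|2 * w t * dw t| <= 2 * K * w t ^+ 2.
Proof.
rewrite normrM -[w t ^+ 2]real_normK ?num_real // normrM ger0_norm //.
have := ler_wpM2l (normr_ge0 (w t)) (dw_le t); nra.
Qed.

(** Gronwall in both time directions: w^2 exp(2Kt) is nondecreasing and w^2 exp(-2Kt) is
    nonincreasing. *)
Lemma linear_growth_neq0 s t : w s != 0 -> w t != 0.
Proof.
move=> ws; apply/negP => /eqP wt.
have ws2 : 0 < w s ^+ 2 by rewrite exprn_even_gt0.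
have [st|/ltW ts] := leP s t.
  have := is_derive_ndecr (dsq (2 * K)) st; rewrite wt expr0n mul0r.
  rewrite leNgt mulr_gt0 ?expR_gt0 // => /(_ _)/notF; apply => r _.
  rewrite mulr_ge0 ?expR_ge0 //.
  by have := dsq_bound r; rewrite ler_norml => /andP[]; lra.
have D r := is_deriveN (dsq (- (2 * K)) r).
have := is_derive_ndecr D ts; rewrite opprfctE wt expr0n mul0r oppr0.
rewrite leNgt oppr_lt0 mulr_gt0 ?expR_gt0 // => /(_ _)/notF; apply => r _.
rewrite -mulNr mulr_ge0 ?expR_ge0 //.
by have := dsq_bound r; rewrite ler_norml => /andP[]; lra.
Qed.

Lemma linear_growth_eq0 s t : w s = 0 -> w t = 0.
Proof.
by move=> ws; apply/eqP; apply: contraPT ws => /(linear_growth_neq0 s)/eqP.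
Qed.

(** A change of sign would produce a zero by the intermediate value theorem, and one zero forces [w]
    to vanish everywhere. *)
Lemma linear_growth_gt0 s t : 0 < w s -> 0 < w t.
Proof.
move=> ws; rewrite ltNge; apply/negP => wt.
suff [c] : exists c, w c = 0.
  by move=> /(linear_growth_eq0 s) E; rewrite E ltxx in ws.
have wc a b : {within `[a, b], continuous w}.
  exact/continuous_subspaceT/(is_derive_continuous wdw).
have [st|/ltW ts] := leP s t.
  have [|c _ wc0] := IVT st (wc _ _) (v := 0); last by exists c.
  by rewrite ge_min le_max wt (ltW ws) orbT.
have [|c _ wc0] := IVT ts (wc _ _) (v := 0); last by exists c.
by rewrite ge_min le_max wt (ltW ws) orbT.
Qed.

Lemma linear_growth_ge0 s t : 0 <= w s -> 0 <= w t.
Proof.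
rewrite le_eqVlt => /predU1P[/esym/linear_growth_eq0 -> //|].
by move=> /linear_growth_gt0/ltW.
Qed.

End LinearlyBounded.
End Derivative.

(** * Global antiderivatives of continuous functions *)

Section Antiderivative.
Variables (R : realType) (f : R -> R).
Hypothesis cf : continuous f.
Let mu := @lebesgue_measure R.

(** The integral starts at -T to have 0 inside the interval; subtracting its value at 0 makes the
    result independent of T ([prim_eq]). *)
Let prim (T t : R) : R :=
  parameterized_integral mu (- T) t f - parameterized_integral mu (- T) 0 f.

Let is_derive_prim (T t : R) : `|t| < T -> is_derive t 1 (prim T) (f t).
Proof.
rewrite ltr_norml => /andP[Tt tT].
have fint : mu.-integrable `[- T, T] (EFin \o f).
  apply: continuous_compact_integrable; first exact: segment_compact.
  exact: continuous_subspaceT.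
have [||d dE] := continuous_FTC1 tT fint. 
- by rewrite /= lte_fin.
- exact: cf.
have -> : prim T = parameterized_integral mu (- T) ^~ f -
                   cst (parameterized_integral mu (- T) 0 f) by apply/funext.
have : is_derive t 1 (fun x => parameterized_integral mu (- T) x f) (f t).
  by apply: DeriveDef; [exact: d|rewrite -derive1E].
by move=> ?; apply: is_derive_eq; rewrite subr0.
Qed.

Let prim_eq (T T' t : R) : `|t| < T -> `|t| < T' -> prim T t = prim T' t.
Proof.
move=> tT tT'.
have D (r : R) : `|r| <= `|t| -> is_derive r 1 (prim T - prim T') 0.
  move=> rt; have d := is_derive_prim (le_lt_trans rt tT).
  have d' := is_derive_prim (le_lt_trans rt tT').
  by apply: is_derive_eq; rewrite subrr.
have cst a b : a <= b -> (forall r, a <= r <= b -> `|r| <= `|t|) ->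
    (prim T - prim T') b - (prim T - prim T') a = 0.
  move=> ab rt; have [| |c _ ->] := @MVT_segment _ (prim T - prim T') (fun=> 0) a b ab.
  - by move=> x; rewrite in_itv /= => /andP[? ?]; apply/D/rt; rewrite !ltW.
  - apply: derivable_within_continuous => x; rewrite in_itv /= => /rt/D[].
    by [].
  - by rewrite mul0r.
have prim0 S : prim S 0 = 0 by rewrite /prim subrr.
have D0 : (prim T - prim T') 0 = 0 by rewrite /= !fctE !prim0 subrr.
suff : (prim T - prim T') t = 0 by move=> /eqP; rewrite /= !fctE subr_eq0 => /eqP.
have [t0|/ltW t0] := leP 0 t.
  have := @cst 0 t t0; rewrite D0 subr0; apply => r /andP[r0 rt].
  by rewrite !ger0_norm.
have := @cst t 0 t0; rewrite D0 sub0r => /(_ _)/eqP; rewrite oppr_eq0 => E.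
apply/eqP/E => r /andP[r0 rt].
by rewrite !ler0_norm // lerN2.
Qed.

Lemma antiderivative :
  exists F : R -> R, F 0 = 0 /\ forall t : R, is_derive t 1 F (f t).
Proof.
(* The window moves with t, but near any given t it may be frozen, by [prim_eq]. *)
exists (fun t => prim (`|t| + 1) t); split; first by rewrite /prim subrr.
move=> t; apply: (near_eq_is_derive (f := prim (`|t| + 1))); last first.
  by apply: is_derive_prim; rewrite ltrDl.
near=> s; apply: prim_eq; last by rewrite ltrDl.
near: s; apply: (@cvgr_lt _ _ _ _ _ `|t|); last by rewrite ltrDl.
exact: norm_continuous.
Unshelve. all: by end_near. Qed.

End Antiderivative.

(** * Sequences with geometrically decreasing steps *)

Section Convergence.
Variable R : realType.

(** With [e n] the tail of the geometric series, [u n - e n] increases and [u n + e n] decreases;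
    the supremum of the former lies between both for every n. *)
Lemma geometric_steps_limit (u : nat -> R) (B : R) :
  (forall n, `|u n.+1 - u n| <= B / 2 ^+ n) ->
  exists l, forall n, `|l - u n| <= 2 * B / 2 ^+ n.
Proof.
move=> uB.
have B0 : 0 <= B by have := uB 0%N; rewrite expr0 divr1; apply: le_trans.
pose e n : R := 2 * B / 2 ^+ n.
have eS n : e n = B / 2 ^+ n + e n.+1.
  by rewrite /e exprS; field; rewrite expf_neq0 ?pnatr_eq0.
have e0 n : 0 <= e n by rewrite /e divr_ge0 ?exprn_ge0 ?mulr_ge0.
have lo : nondecreasing_seq (fun n => u n - e n).
  by apply/nondecreasing_seqP => n; have := uB n; have := eS n; rewrite ler_norml; lra.
have up : nonincreasing_seq (fun n => u n + e n).
  by apply/nonincreasing_seqP => n; have := uB n; have := eS n; rewrite ler_norml; lra.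
have loup n m : u n - e n <= u m + e m.
  have [nm|/ltnW mn] := leqP n m.
    by have := lo _ _ nm; have := e0 m; lra.
  by have := up _ _ mn; have := e0 n; rewrite /=; lra.
pose A := range (fun n => u n - e n).
have supA : has_sup A.
  split; first by exists (u 0%N - e 0%N), 0%N.
  by exists (u 0%N + e 0%N) => _ [n _ <-].
exists (sup A) => n; rewrite ler_norml.
have : u n - e n <= sup A by apply: ub_le_sup; [exact: supA.2|exists n].
have : sup A <= u n + e n by apply: ge_sup; [exact: supA.1|move=> _ [m _ <-]].
by rewrite -/(e n); lra.
Qed.

Lemma half_pow_lt (B e : R) : 0 < e -> exists n, B / 2 ^+ n < e.
Proof.
move=> e0; have : geometric B (2^-1 : R) @ \oo --> 0.
  by apply: cvg_geometric; rewrite ger0_norm ?invf_lt1 ?ltr1n.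
move=> /cvgr_lt/(_ e e0)[N _ /(_ N (leqnn _))] /=.
by rewrite exprVn; exists N.
Qed.

Lemma eq0_half_pow (a B : R) : (forall n, `|a| <= B / 2 ^+ n) -> a = 0.
Proof.
move=> aB; apply/eqP; rewrite -normr_le0 leNgt; apply/negP => a0.
by have [n] := half_pow_lt B a0; rewrite ltNge aB.
Qed.

End Convergence.

(** * Global solutions of planar Lipschitz systems by Picard iteration *)

Section Picard.
Variables (R : realType) (F G : R -> R -> R) (L : R).
Hypothesis L0 : 0 < L.
Hypothesis F_lip : forall x y x' y',
  `|F x y - F x' y'| <= L * (`|x - x'| + `|y - y'|).
Hypothesis G_lip : forall x y x' y',
  `|G x y - G x' y'| <= L * (`|x - x'| + `|y - y'|).

(* Bielecki's weight: in the weighted norm the Picard operator is a contraction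
   globally in time. *)
Definition bielecki (t : R) : R := expR (4 * L * `|t|).

(** Integrating exp(4L|s|) gains a factor 1/(4L), which absorbs the Lipschitz constant and leaves
    1/4. *)
Lemma bielecki_integral (h dh : R -> R) (C : R) :
  (forall t : R, is_derive t 1 h (dh t)) -> h 0 = 0 ->
  (forall t, `|dh t| <= L * C * bielecki t) ->
  forall t, `|h t| <= C / 4 * bielecki t.
Proof.
move=> hdh h0 dhC.
have C0 : 0 <= C.
  have := le_trans (normr_ge0 _) (dhC 0).
  by rewrite /bielecki normr0 mulr0 expR0 mulr1 pmulr_rge0.
(* The one-sided bound for nonnegative times suffices: the other cases follow by replacing h with -h
   and t with -t. *)
have main (g dg : R -> R) : (forall t : R, is_derive t 1 g (dg t)) -> g 0 = 0 ->
    (forall t, `|dg t| <= L * C * bielecki t) ->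
    forall t, 0 <= t -> g t <= C / 4 * bielecki t.
  move=> gdg g0 dgC t t0.
  pose k s := C / 4 * expR (4 * L * s) - g s.
  have kd (s : R) : is_derive s 1 k (L * C * expR (4 * L * s) - dg s).
    have -> : k = (C / 4) \*: (fun s => expR (4 * L * s)) - g by apply/funext.
    have ? := gdg s; have ? := is_derive_expRM (4 * L) s.
    by apply: is_derive_eq; rewrite /GRing.scale /=; field.
  have : k 0 <= k t.
    apply: (is_derive_ndecr kd) => // s /andP[s0 _].
    by have := dgC s; rewrite /bielecki (ger0_norm s0) ler_norml => /andP[_]; lra.
  rewrite /k g0 mulr0 expR0 /bielecki ger0_norm //; lra.
move=> t.
have hNd (s : R) : is_derive s 1 (- h) (- dh s) by have ? := hdh s; exact: is_deriveN.
have flip (g dg : R -> R) : (forall t : R, is_derive t 1 g (dg t)) ->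
    forall s : R, is_derive s 1 (g \o -%R) (- dg (- s)).
  by move=> gdg s; have ? := gdg (- s); apply: is_derive_eq; rewrite mulrN1.
have bN s : bielecki (- s) = bielecki s by rewrite /bielecki normrN.
have [t0|/ltW t0] := leP 0 t.
  rewrite ler_norml lerNl; apply/andP; split; last exact: (main h dh).
  apply: (main (- h) (fun s => - dh s)) => //; first by rewrite opprfctE h0 oppr0.
  by move=> s; rewrite normrN.
rewrite -bN ler_norml lerNl; apply/andP; split.
  have := main ((- h) \o -%R) (fun s => - - dh (- s)) (flip _ _ hNd).
  rewrite /= !opprfctE oppr0 h0 oppr0 => /(_ erefl) H.
  have := H _ (- t); rewrite opprK; apply; last by rewrite oppr_ge0.
  by move=> s; rewrite opprK -bN.
have := main (h \o -%R) (fun s => - dh (- s)) (flip _ _ hdh).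
rewrite /= oppr0 h0 => /(_ erefl) H.
have := H _ (- t); rewrite opprK; apply; last by rewrite oppr_ge0.
by move=> s; rewrite normrN -bN.
Qed.

Lemma lipschitz_continuous_comp (H : R -> R -> R) (x y : R -> R) :
  (forall x y x' y', `|H x y - H x' y'| <= L * (`|x - x'| + `|y - y'|)) ->
  continuous x -> continuous y -> continuous (fun t => H (x t) (y t)).
Proof.
move=> Hlip cx cy t; apply/cvgrPdist_lt => e e0.
have e'0 : 0 < e / (2 * L) by rewrite divr_gt0 ?mulr_gt0.
near=> s; apply: le_lt_trans (Hlip _ _ _ _) _.
have -> : e = L * (e / (2 * L) + e / (2 * L)) by field; rewrite gt_eqF.
rewrite ltr_pM2l // ltrD //; near: s.
  by have /cvgrPdist_lt := cx t; apply.
by have /cvgrPdist_lt := cy t; apply.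
Unshelve. all: by end_near. Qed.

(** The default value 0 off continuous functions makes this total, so that [picard] can be defined
    before its iterates are known to be continuous. *)
Let prim (f : R -> R) : R -> R :=
  if pselect (continuous f) is left cf then projT1 (cid (antiderivative cf))
  else cst 0.

Let prim0 f : prim f 0 = 0.
Proof. by rewrite /prim; case: pselect => // cf; case: cid => ? []. Qed.

Let is_derive_prim f (t : R) : continuous f -> is_derive t 1 (prim f) (f t).
Proof. by rewrite /prim; case: pselect => // cf _; case: cid => ? []. Qed.

Section InitialValue.
Variables p q : R.

Fixpoint picard n : (R -> R) * (R -> R) :=
  if n is m.+1 then
    let xy := picard m in
    (fun t => p + prim (fun s => F (xy.1 s) (xy.2 s)) t,
     fun t => q + prim (fun s => G (xy.1 s) (xy.2 s)) t)
  else (cst p, cst q).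

Let x n := (picard n).1.
Let y n := (picard n).2.

Let is_derive_cD (c : R) f (t d : R) : is_derive t 1 f d ->
  is_derive t 1 (fun s => c + f s) d.
Proof.
move=> fd; have -> : (fun s => c + f s) = cst c + f by apply/funext.
by apply: is_derive_eq; rewrite add0r.
Qed.

Let picard_continuous n : continuous (x n) /\ continuous (y n).
Proof.
elim: n => [|n [cx cy]]; first by split; exact: cst_continuous.
by split; apply: is_derive_continuous => t; apply: is_derive_cD;
  apply: is_derive_prim; apply: lipschitz_continuous_comp.
Qed.

Let cF n : continuous (fun t => F (x n t) (y n t)).
Proof. by have [? ?] := picard_continuous n; exact: lipschitz_continuous_comp. Qed.

Let cG n : continuous (fun t => G (x n t) (y n t)).
Proof. by have [? ?] := picard_continuous n; exact: lipschitz_continuous_comp. Qed.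

Let picard0 n : x n 0 = p /\ y n 0 = q.
Proof. by case: n => [|n]; rewrite /x /y //= !prim0 !addr0. Qed.

Let dx n (t : R) : is_derive t 1 (x n.+1) (F (x n t) (y n t)).
Proof. exact: (is_derive_cD p (is_derive_prim t (@cF n))). Qed.

Let dy n (t : R) : is_derive t 1 (y n.+1) (G (x n t) (y n t)).
Proof. exact: (is_derive_cD q (is_derive_prim t (@cG n))). Qed.

(** This controls the first Picard step, along which the velocity is the constant (F p q, G p q). *)
Let C := (`|F p q| + `|G p q|) / L.

Let bielecki_ge1 t : 1 <= bielecki t.
Proof. by rewrite -expR0 ler_expR !mulr_ge0 // ltW. Qed.

(** Two components at 1/4 each give the contraction factor 1/2. [X] and [Y] are arbitrary so as to
    cover both the next iterate and the Picard image of the limit. *)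
Let picard_step n (X Y dX dY : R -> R) (B : R) :
  (forall t : R, is_derive t 1 X (dX t)) -> (forall t : R, is_derive t 1 Y (dY t)) ->
  X 0 = p -> Y 0 = q ->
  (forall t, `|dX t - F (x n t) (y n t)| <= L * B * bielecki t) ->
  (forall t, `|dY t - G (x n t) (y n t)| <= L * B * bielecki t) ->
  forall t, `|X t - x n.+1 t| + `|Y t - y n.+1 t| <= B / 2 * bielecki t.
Proof.
move=> Xd Yd X0 Y0 XB YB t.
have := @bielecki_integral (X - x n.+1) _ B
  (fun t => is_deriveB (Xd t) (dx n t)) _ XB t.
have := @bielecki_integral (Y - y n.+1) _ B
  (fun t => is_deriveB (Yd t) (dy n t)) _ YB t.
rewrite !fctE X0 Y0 !(picard0 n.+1).1 !(picard0 n.+1).2 !subrr.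
by move=> /(_ erefl) h /(_ erefl); lra.
Qed.

Let C_ge0 : 0 <= C.
Proof. by rewrite divr_ge0 ?addr_ge0 // ltW. Qed.

Let bielecki_continuous : continuous bielecki.
Proof.
move=> t; apply: continuous_comp; last exact: continuous_expR.
by apply: cvgM; [exact: cvg_cst|exact: norm_continuous].
Qed.

Let picard_dist n t :
  `|x n.+1 t - x n t| + `|y n.+1 t - y n t| <= C / 2 ^+ n * bielecki t.
Proof.
elim: n t => [|n IH] t; last first.
  rewrite (_ : C / 2 ^+ n.+1 = C / 2 ^+ n / 2); last first.
    by rewrite exprSr invfM mulrA.
  apply: (@picard_step n _ _ _ _ (C / 2 ^+ n) (dx n.+1) (dy n.+1)).
  - by have [] := picard0 n.+2.
  - by have [] := picard0 n.+2.
  - move=> s; apply: le_trans (F_lip _ _ _ _) _.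
    by rewrite -mulrA ler_pM2l.
  - move=> s; apply: le_trans (G_lip _ _ _ _) _.
    by rewrite -mulrA ler_pM2l.
have first (h : R -> R) (c c0 : R) : (forall t : R, is_derive t 1 h c) ->
    h 0 = c0 -> `|h t - c0| <= `|c| / L / 4 * bielecki t.
  move=> hd h0.
  apply: (@bielecki_integral (h - cst c0) (fun=> c - 0)).
  - by rewrite -[LHS]/(h 0 - c0) h0 subrr.
  - move=> s; rewrite subr0 mulrCA divff ?gt_eqF // mulr1.
    by rewrite ler_peMr.
have [x0 y0] := picard0 1.
have := first (x 1) (F p q) p (dx 0) x0; have := first (y 1) (G p q) q (dy 0) y0.
rewrite expr0 divr1 /C [X in X -> _]/=.
have := bielecki_ge1 t; have := divr_ge0 (normr_ge0 (F p q)) (ltW L0).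
have := divr_ge0 (normr_ge0 (G p q)) (ltW L0).
rewrite /x /y /= mulrDl; nra.
Qed.

Lemma cauchy_lipschitz : exists X Y : R -> R, [/\ X 0 = p, Y 0 = q,
  forall t : R, is_derive t 1 X (F (X t) (Y t)) &
  forall t : R, is_derive t 1 Y (G (X t) (Y t))].
Proof.
have lim (u : nat -> R -> R) :
    (forall n t, `|u n.+1 t - u n t| <= C / 2 ^+ n * bielecki t) ->
    (forall n, continuous (u n)) ->
  exists2 l, continuous l & forall n t, `|l t - u n t| <= 2 * C * bielecki t / 2 ^+ n.
  move=> uC cu.
  have /choice[l lu] t : exists l, forall n, `|l - u n t| <= 2 * C * bielecki t / 2 ^+ n.
    rewrite -mulrA; apply: geometric_steps_limit => n.
    by rewrite mulrAC.
  exists l => // t; apply/cvgrPdist_lt => e e0.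
  have e3 : 0 < e / 3 by rewrite divr_gt0.
  have [n Bn] := half_pow_lt (2 * C * (bielecki t + 1)) e3.
  near=> s.
  (* Three-epsilon argument: near t the weight stays below [bielecki t + 1], so the convergence is
     locally uniform. *)
  have -> : l t - l s = (l t - u n t) + (u n t - u n s) - (l s - u n s) by ring.
  have -> : e = e / 3 + e / 3 + e / 3 by field.
  have weight_lt r : bielecki r <= bielecki t + 1 -> `|l r - u n r| < e / 3.
    move=> rt; apply: le_lt_trans Bn; apply: le_trans (lu r n) _.
    by rewrite ler_wpM2r ?invr_ge0 ?exprn_ge0 //; apply: ler_wpM2l rt; exact: mulr_ge0.
  apply: le_lt_trans (ler_normB _ _) _; rewrite ltrD //.
    apply: le_lt_trans (ler_normD _ _) _; rewrite ltrD //.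
      by rewrite weight_lt // lerDl.
    near: s.
    by have /cvgrPdist_lt := cu n t; apply.
  rewrite weight_lt // ltW //; near: s.
  apply: (@cvgr_lt _ _ _ _ _ (bielecki t)); last by rewrite ltrDl.
  exact: bielecki_continuous.
have [X cX Xx] : exists2 l, continuous l &
    forall n t, `|l t - x n t| <= 2 * C * bielecki t / 2 ^+ n.
  apply: lim => n; last by have [] := picard_continuous n.
  by move=> t; apply: le_trans (picard_dist n t); rewrite lerDl.
have [Y cY Yy] : exists2 l, continuous l &
    forall n t, `|l t - y n t| <= 2 * C * bielecki t / 2 ^+ n.
  apply: lim => n; last by have [] := picard_continuous n.
  by move=> t; apply: le_trans (picard_dist n t); rewrite lerDr.
(* [X'], [Y'] is the Picard image of the limit; it is within every C/2^n-sized weighted distance of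
   the limit, hence equal to it, which yields the differential equations. *)
pose X' t := p + prim (fun s => F (X s) (Y s)) t.
pose Y' t := q + prim (fun s => G (X s) (Y s)) t.
have dX' (t : R) : is_derive t 1 X' (F (X t) (Y t)).
  exact/is_derive_cD/is_derive_prim/lipschitz_continuous_comp.
have dY' (t : R) : is_derive t 1 Y' (G (X t) (Y t)).
  exact/is_derive_cD/is_derive_prim/lipschitz_continuous_comp.
have X'0 : X' 0 = p by rewrite /X' prim0 addr0.
have Y'0 : Y' 0 = q by rewrite /Y' prim0 addr0.
have XYx n t : `|X t - x n t| + `|Y t - y n t| <= 4 * C / 2 ^+ n * bielecki t.
  by have := Xx n t; have := Yy n t; lra.
have step n t : `|X' t - x n.+1 t| + `|Y' t - y n.+1 t| <=
    4 * C / 2 ^+ n / 2 * bielecki t.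
  apply: (picard_step dX' dY' X'0 Y'0) => s.
    by apply: le_trans (F_lip _ _ _ _) _; rewrite -mulrA ler_pM2l.
  by apply: le_trans (G_lip _ _ _ _) _; rewrite -mulrA ler_pM2l.
have close n t : `|X' t - X t| + `|Y' t - Y t| <= 4 * C * bielecki t / 2 ^+ n.
  have := step n t; have := XYx n.+1 t.
  have := ler_distD (x n.+1 t) (X' t) (X t).
  have := ler_distD (y n.+1 t) (Y' t) (Y t).
  rewrite (distrC (x n.+1 t)) (distrC (y n.+1 t)) exprSr invfM; lra.
have XX' : X' = X.
  apply/funext => t; apply/eqP; rewrite -subr_eq0; apply/eqP.
  apply: eq0_half_pow => n; apply: le_trans (close n t).
  by rewrite lerDl.
have YY' : Y' = Y.
  apply/funext => t; apply/eqP; rewrite -subr_eq0; apply/eqP.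
  apply: eq0_half_pow => n; apply: le_trans (close n t).
  by rewrite lerDr.
by move: dX' dY' X'0 Y'0; rewrite XX' YY'; exists X, Y.
Unshelve. all: by end_near. Qed.

End InitialValue.
End Picard.

(** * The projected flow *)

Section LipschitzOnSquare.
Variable R : realType.
Implicit Types f g : R -> R -> R.

Definition in01 (x : R) := 0 <= x <= 1.

(** The bound on |f| is carried along so that the class is closed under products. *)
Definition square_lipschitz f := exists2 K : R, 0 <= K &
  forall x y x' y', in01 x -> in01 y -> in01 x' -> in01 y' ->
    `|f x y| <= K /\ `|f x y - f x' y'| <= K * (`|x - x'| + `|y - y'|).

Lemma square_lipschitz_cst c : square_lipschitz (fun _ _ => c).
Proof.
exists `|c| => // x y x' y' _ _ _ _; split => //.
by rewrite subrr normr0 mulr_ge0 ?addr_ge0.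
Qed.

Lemma square_lipschitz_fst : square_lipschitz (fun x _ => x).
Proof.
exists 1 => // x y x' y' /andP[x0 x1] _ _ _.
by rewrite mul1r lerDl normr_ge0 ger0_norm.
Qed.

Lemma square_lipschitz_snd : square_lipschitz (fun _ y => y).
Proof.
exists 1 => // x y x' y' _ /andP[y0 y1] _ _.
by rewrite mul1r lerDr normr_ge0 ger0_norm.
Qed.

Lemma square_lipschitzD f g : square_lipschitz f -> square_lipschitz g ->
  square_lipschitz (fun x y => f x y + g x y).
Proof.
move=> [K K0 fK] [M M0 gM]; exists (K + M); first exact: addr_ge0.
move=> x y x' y' x01 y01 x'01 y'01.
have [f1 f2] := fK _ _ _ _ x01 y01 x'01 y'01.
have [g1 g2] := gM _ _ _ _ x01 y01 x'01 y'01.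
split; first by rewrite (le_trans (ler_normD _ _)) // lerD.
by rewrite opprD addrACA mulrDl (le_trans (ler_normD _ _)) // lerD.
Qed.

Lemma square_lipschitzM f g : square_lipschitz f -> square_lipschitz g ->
  square_lipschitz (fun x y => f x y * g x y).
Proof.
move=> [K K0 fK] [M M0 gM]; exists (K * M + K * M); first by rewrite addr_ge0 ?mulr_ge0.
move=> x y x' y' x01 y01 x'01 y'01.
have [f1 f2] := fK _ _ _ _ x01 y01 x'01 y'01.
have [g1 g2] := gM _ _ _ _ x01 y01 x'01 y'01.
have [f1' _] := fK _ _ _ _ x'01 y'01 x01 y01.
split.
  by rewrite normrM (le_trans (ler_pM _ _ f1 g1)) // lerDl mulr_ge0.
have -> : f x y * g x y - f x' y' * g x' y' =
  g x y * (f x y - f x' y') + f x' y' * (g x y - g x' y') by ring.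
rewrite mulrDl (le_trans (ler_normD _ _)) // !normrM lerD //.
  by rewrite [K * M]mulrC -mulrA ler_pM.
by rewrite -mulrA ler_pM.
Qed.

Lemma square_lipschitzN f : square_lipschitz f -> square_lipschitz (fun x y => - f x y).
Proof.
move=> [K K0 fK]; exists K => // x y x' y' x01 y01 x'01 y'01.
by rewrite normrN -opprD normrN; exact: fK.
Qed.

Definition clamp (x : R) := Num.max 0 (Num.min x 1).

Lemma clamp_in01 x : in01 (clamp x).
Proof. by rewrite /in01 /clamp le_max lexx ge_max ler01 ge_min lexx orbT. Qed.

Lemma clamp_id x : in01 x -> clamp x = x.
Proof. by move=> /andP[x0 x1]; rewrite /clamp min_l // max_r. Qed.

Lemma clamp_le x : `|clamp x| <= `|x|.
Proof.
rewrite /clamp; have [x1|x1] := leP x 1; have := ler_norm x.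
  by have [//|] := leP 0 x; rewrite normr0.
by rewrite max_r // normr1 => h; lra.
Qed.

Lemma clamp_lip x x' : `|clamp x - clamp x'| <= `|x - x'|.
Proof.
rewrite /clamp.
case: (leP x 1) => ?; case: (leP x' 1) => ?;
  rewrite ?(max_r ler01); repeat case: (leP 0 _) => ?;
  rewrite real_ler_norml ?num_real //; case: (ger0P (x - x')) => ?; apply/andP; split; lra.
Qed.

Lemma square_lipschitz_clamp f : square_lipschitz f -> exists2 L, 0 < L &
  forall x y x' y', `|f (clamp x) (clamp y) - f (clamp x') (clamp y')| <=
    L * (`|x - x'| + `|y - y'|).
Proof.
move=> [K K0 fK]; exists (K + 1); first by rewrite ltr_wpDl.
move=> x y x' y'.
have [_] := fK _ _ _ _ (clamp_in01 x) (clamp_in01 y) (clamp_in01 x') (clamp_in01 y').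
move=> /le_trans; apply.
by rewrite ler_pM ?addr_ge0 ?lerDl // lerD ?clamp_lip.
Qed.

Lemma square_lipschitz_field_u : square_lipschitz (@field_u R).
Proof.
rewrite /field_u; repeat (
  apply: square_lipschitzD || apply: square_lipschitzM || apply: square_lipschitzN ||
  exact: square_lipschitz_cst || exact: square_lipschitz_fst ||
  exact: square_lipschitz_snd).
Qed.

Lemma square_lipschitz_field_v : square_lipschitz (@field_v R).
Proof.
rewrite /field_v; repeat (
  apply: square_lipschitzD || apply: square_lipschitzM || apply: square_lipschitzN ||
  exact: square_lipschitz_cst || exact: square_lipschitz_fst ||
  exact: square_lipschitz_snd).
Qed.

End LipschitzOnSquare.

Section Factors.
Variable R : realType.

(* With [z = 1 - x - y] the flow is symmetric in [x], [y], [z]: each coordinate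
   [a] evolves by [a' = a * growth a b c], [b] and [c] being the other two. *)
Definition growth (a b c : R) : R := 2 * (1 - 2 * a) * (1 - a - 6 * b * c).

Lemma field_uE (x y : R) : field_u x y = x * growth x y (1 - x - y).
Proof. by rewrite /field_u /growth; ring. Qed.

Lemma field_vE (x y : R) : field_v x y = y * growth y x (1 - x - y).
Proof. by rewrite /field_v /growth; ring. Qed.

Lemma field_uvE (x y : R) :
  - (field_u x y + field_v x y) = (1 - x - y) * growth (1 - x - y) x y.
Proof. by rewrite /field_u /field_v /growth; ring. Qed.

(** The constants are 8 = 1 + 1 + 6 and 48 = 2 * 3 * 8, with |1 - 2a| <= 3. *)
Lemma growth_le (a b c : R) : `|a| <= 1 -> `|b| <= 1 -> `|c| <= 1 ->
  `|growth a b c| <= 48 /\ `|1 - a - 6 * b * c| <= 8.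
Proof.
move=> a1 b1 c1.
have bc : `|b * c| <= 1 by rewrite normrM mulr_ile1.
have h8 : `|1 - a - 6 * b * c| <= 8.
  by move: a1 bc; rewrite -mulrA !ler_norml => /andP[? ?] /andP[? ?]; lra.
split => //; rewrite /growth -mulrA !normrM (ger0_norm (ler0n _ 2)).
rewrite (_ : 48 = 2 * (6 * 8 / 2)); last by field.
rewrite ler_pM2l // (_ : 6 * 8 / 2 = 3 * 8); last by field.
by rewrite ler_pM //; move: a1; rewrite !ler_norml => /andP[? ?]; lra.
Qed.

End Factors.

(** * Existence of the flow on the closed triangle *)

Section FlowExists.
Variable R : realType.

(** Along the clamped field each of X, Y and 1 - X - Y satisfies |w'| <= 48 |w|, hence keeps its
    sign. So the solution stays in the triangle, where clamping is the identity. *)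
Lemma trajectory_exists (p : R * R) : triangle p -> exists X Y : R -> R,
  [/\ X 0 = p.1, Y 0 = p.2, forall t, triangle (X t, Y t),
   forall t : R, is_derive t 1 X (field_u (X t) (Y t)) &
   forall t : R, is_derive t 1 Y (field_v (X t) (Y t))].
Proof.
move=> [p1 [p2 p12]].
have [Lu Lu0 uL] := square_lipschitz_clamp (square_lipschitz_field_u R).
have [Lv Lv0 vL] := square_lipschitz_clamp (square_lipschitz_field_v R).
pose cu x y : R := field_u (clamp x) (clamp y).
pose cv x y : R := field_v (clamp x) (clamp y).
have uL' x y x' y' : `|cu x y - cu x' y'| <= (Lu + Lv) * (`|x - x'| + `|y - y'|).
  by apply: le_trans (uL _ _ _ _) _; rewrite ler_wpM2r ?addr_ge0 // lerDl ltW.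
have vL' x y x' y' : `|cv x y - cv x' y'| <= (Lu + Lv) * (`|x - x'| + `|y - y'|).
  by apply: le_trans (vL _ _ _ _) _; rewrite ler_wpM2r ?addr_ge0 // lerDr ltW.
have [X [Y [X0 Y0 dX dY]]] := cauchy_lipschitz (addr_gt0 Lu0 Lv0) uL' vL' p.1 p.2.
have small (x : R) : `|clamp x| <= 1.
  by have /andP[? ?] := clamp_in01 x; rewrite ger0_norm.
have smallz (x y : R) : `|1 - clamp x - clamp y| <= 1.
  have /andP[? ?] := clamp_in01 x; have /andP[? ?] := clamp_in01 y.
  by rewrite ler_norml; apply/andP; split; lra.
have Xge0 t : 0 <= X t.
  apply: (@linear_growth_ge0 _ _ _ 48 dX _ 0 t); last by rewrite X0.
  move=> s; rewrite /cu field_uE normrM mulrC.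
  rewrite ler_pM ?clamp_le //.
  by have [] := growth_le (small (X s)) (small (Y s)) (smallz (X s) (Y s)).
have Yge0 t : 0 <= Y t.
  apply: (@linear_growth_ge0 _ _ _ 48 dY _ 0 t); last by rewrite Y0.
  move=> s; rewrite /cv field_vE normrM mulrC.
  rewrite ler_pM ?clamp_le //.
  by have [] := growth_le (small (Y s)) (small (X s)) (smallz (X s) (Y s)).
have dZ (t : R) : is_derive t 1 (cst 1 - X - Y) (- (cu (X t) (Y t) + cv (X t) (Y t))).
  have ? := dX t; have ? := dY t.
  by apply: is_derive_eq; rewrite sub0r opprD.
(* This needs x, y >= 0, which is why the signs of X and Y are settled before that of 1 - X - Y. *)
have clampz_le (x y : R) : 0 <= x -> 0 <= y -> `|1 - clamp x - clamp y| <= `|1 - x - y|.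
  move=> x0 y0; rewrite /clamp.
  case: (leP x 1) => ?; case: (leP y 1) => ?; rewrite ?(max_r ler01) ?(max_r x0) ?(max_r y0) //;
  rewrite real_ler_norml ?num_real //; case: (ger0P (1 - x - y)) => ?; apply/andP; split; lra.
have Zge0 t : 0 <= 1 - X t - Y t.
  apply: (@linear_growth_ge0 _ _ _ 48 dZ _ 0 t).
    move=> s; rewrite /cu /cv field_uvE normrM mulrC.
    rewrite ler_pM ?clampz_le //.
    by have [] := growth_le (smallz (X s) (Y s)) (small (X s)) (small (Y s)).
  by rewrite !fctE X0 Y0; lra.
have X01 t : clamp (X t) = X t.
  by rewrite clamp_id // /in01 Xge0 /=; have := Zge0 t; have := Yge0 t; lra.
have Y01 t : clamp (Y t) = Y t.
  by rewrite clamp_id // /in01 Yge0 /=; have := Zge0 t; have := Xge0 t; lra.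
exists X, Y; split => // t.
- by split; [|split] => //=; have := Zge0 t; lra.
- by have := dX t; rewrite /cu X01 Y01.
- by have := dY t; rewrite /cv X01 Y01.
Qed.

(** This keeps the quantification over flows from being vacuous. Outside the triangle the
    trajectories are constant by convention. *)
Lemma projected_ricci_flow_exists :
  exists phi : R -> R * R -> R * R, is_projected_ricci_flow phi.
Proof.
have /choice[f fP] (p : R * R) : exists f : R -> R * R, triangle p ->
    f 0 = p /\ forall t, triangle (f t) /\
      is_derive t 1 (fun s => (f s).1) (field_u (f t).1 (f t).2) /\
      is_derive t 1 (fun s => (f s).2) (field_v (f t).1 (f t).2).
  have [pT|npT] := pselect (triangle p); last by exists (fun=> p) => /npT.
  have [X [Y [X0 Y0 XYT dX dY]]] := trajectory_exists pT.
  exists (fun t => (X t, Y t)) => _; split=> [|t]; last first.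
    by split; [exact: XYT|split; [exact: dX|exact: dY]].
  by rewrite X0 Y0 -surjective_pairing.
by exists (fun t p => f p t).
Qed.

End FlowExists.

(** * Invariant metrics of positive d-curvature *)

Section RicScal.
Variable R : realType.

Lemma ricci_opE (x y z : R) : x != 0 -> y != 0 -> z != 0 ->
  ricci_op x y z = diag_mx (ricci_eigs x y z).
Proof.
move=> x0 y0 z0; apply/matrixP => -[[|[|[|[|[|[|//]]]]]] ?] -[[|[|[|[|[|[|//]]]]]] ?];
  rewrite !mxE !delta_row6 ricciE //= ?(mulr0n, mulr1n) /ricci_eig /weight /=;
  by field; rewrite ?x0 ?y0 ?z0.
Qed.

Lemma ric_scal_pos (x y : R) d : (0 < d)%N ->
  let z := 1 - x - y in
  0 < x -> 0 < y -> 0 < z ->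
  y ^+ 2 + z ^+ 2 < 6 * y * z + x ^+ 2 ->
  x ^+ 2 + z ^+ 2 < 6 * x * z + y ^+ 2 ->
  x ^+ 2 + y ^+ 2 < 6 * x * y + z ^+ 2 -> ric_scal d (x, y).
Proof.
move=> d0 z x0 y0 z0 hx hy hz; split; first by split; [|split] => //=; move: z0; rewrite /z; lra.
rewrite /= -/z ricci_opE ?gt_eqF //.
by apply: positive_d_curvature_diag => // i; exact: ricci_eigs_gt0.
Qed.

(** Here z = 1 - 2s, so 18 s < 1 is the condition 16 s < z. *)
Lemma not_ric_scal_diagonal (s : R) d : (1 <= d <= 6)%N ->
  0 < s -> 18 * s < 1 -> ~ ric_scal d (s, s).
Proof.
move=> d16 s0 s18 [_] /=; have z0 : 0 < 1 - s - s by lra.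
rewrite ricci_opE ?gt_eqF //; apply: not_positive_d_curvature_ricci_eigs => //; lra.
Qed.

(* The sides x = 1/2, y = 1/2, z = 1/2 are the Kaehler metrics x = y + z, y = x + z,
   z = x + y. *)
Definition medial_triangle : set (R * R) :=
  [set p | p.1 < 1 / 2 /\ p.2 < 1 / 2 /\ 1 / 2 < p.1 + p.2].

(** The triangle inequality |y - z| < x gives y^2 + z^2 < x^2 + 2yz < x^2 + 6yz, and likewise for
    the permutations. *)
Lemma medial_triangle_ric_scal d : (0 < d)%N -> medial_triangle `<=` ric_scal d.
Proof.
move=> d0 [x y] [/= x1 [y1 xy1]]; have [x0 [y0 z0]] : 0 < x /\ 0 < y /\ 0 < 1 - x - y.
  by split; [|split]; lra.
apply: ric_scal_pos => //; nra.
Qed.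

(** The set is convex, hence a union of segments issuing from (2/5, 2/5). Connectedness is what
    makes the open set a region. *)
Lemma medial_triangle_connected : connected medial_triangle.
Proof.
pose seg (p : R * R) (t : R) : R * R :=
  (2 / 5 + t * (p.1 - 2 / 5), 2 / 5 + t * (p.2 - 2 / 5)).
have -> : medial_triangle = \bigcup_(p in medial_triangle) (seg p @` `[0, 1]).
  apply/seteqP; split => [p pM|_ [p [p1 [p2 p12]] [t t01 <-]]].
    exists p => //; exists 1; first by rewrite /= in_itv /= ler01 lexx.
    by rewrite /seg !mul1r [RHS]surjective_pairing; congr (_, _); ring.
  move: t01; rewrite /= in_itv /= => /andP[t0 t1]; rewrite /seg /medial_triangle /=.
  by split; [|split]; nra.
apply: bigcup_connected.
  exists (2 / 5, 2 / 5) => p _; exists 0; first by rewrite /= in_itv /= ler01 lexx.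
  by rewrite /seg !mul0r !addr0.
move=> p _; apply: connected_continuous_connected; first exact: segment_connected.
apply: continuous_subspaceT => t.
have lin (c d : R) : (c + s * d) @[s --> t] --> c + t * d.
  by apply: cvgD; [exact: cvg_cst|apply: cvgM; [exact: cvg_id|exact: cvg_cst]].
exact: (cvg_pair (lin (2 / 5) (p.1 - 2 / 5)) (lin (2 / 5) (p.2 - 2 / 5))).
Qed.

Lemma medial_triangle_open : open medial_triangle.
Proof.
have -> : medial_triangle = [set p | p.1 < 1 / 2] `&` ([set p | p.2 < 1 / 2] `&`
    [set p | 1 / 2 < p.1 + p.2]) by [].
apply: openI; last apply: openI.
- apply: (@open_comp _ _ fst [set x : R | x < 1 / 2]); last exact: open_lt.
  by move=> p _; exact: cvg_fst.
- apply: (@open_comp _ _ snd [set x : R | x < 1 / 2]); last exact: open_lt.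
  by move=> p _; exact: cvg_snd.
- apply: (@open_comp _ _ (fun p => p.1 + p.2) [set x : R | 1 / 2 < x]); last exact: open_gt.
  by move=> p _; apply: cvgD; [exact: cvg_fst|exact: cvg_snd].
Qed.

End RicScal.

(** * Trajectories *)

Section Trajectory.
Variables (R : realType) (X Y : R -> R).
Hypothesis XYT : forall t, triangle (X t, Y t).
Hypothesis dX : forall t : R, is_derive t 1 X (field_u (X t) (Y t)).
Hypothesis dY : forall t : R, is_derive t 1 Y (field_v (X t) (Y t)).

Let Z t := 1 - X t - Y t.

Let XYZ_bounds t : [/\ 0 <= X t <= 1, 0 <= Y t <= 1 & 0 <= Z t <= 1].
Proof.
have [/= x0 [y0 xy1]] := XYT t.
by split; apply/andP; split; rewrite /Z; lra.
Qed.

Let XYZ_norm t : [/\ `|X t| <= 1, `|Y t| <= 1 & `|Z t| <= 1].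
Proof.
by have [/andP[? ?] /andP[? ?] /andP[? ?]] := XYZ_bounds t; rewrite !ger0_norm.
Qed.

(** [growth] contains the factor 1 - 2a = 2 (1/2 - a); the cofactor is at most 4 * 1 * 8 in absolute
    value. *)
Let half_growth (a b c : R) : 0 <= a <= 1 -> `|b| <= 1 -> `|c| <= 1 ->
  `|- (a * growth a b c)| <= 32 * `|1 / 2 - a|.
Proof.
move=> /andP[a0 a1] b1 c1.
have -> : - (a * growth a b c) =
  4 * (a * - (1 - a - 6 * b * c)) * (1 / 2 - a) by rewrite /growth; field.
rewrite normrM ler_wpM2r // normrM ger0_norm // (_ : 32 = 4 * 8); last by ring.
have a1' : `|a| <= 1 by rewrite ger0_norm.
rewrite ler_pM2l // -[leRHS]mul1r normrM normrN ler_pM //.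
by have [_] := growth_le a1' b1 c1.
Qed.

Lemma trajectory_x_lt_half t : X 0 < 1 / 2 -> X t < 1 / 2.
Proof.
rewrite -subr_gt0 => X0; rewrite -subr_gt0.
have d (s : R) : is_derive s 1 (cst (1 / 2) - X) (- (X s * growth (X s) (Y s) (Z s))).
  by have ? := dX s; apply: is_derive_eq; rewrite sub0r field_uE.
apply: (linear_growth_gt0 (K := 32) d _ (s := 0)) => // s.
by have [? ? ?] := XYZ_bounds s; have [? ? ?] := XYZ_norm s; exact: half_growth.
Qed.

Lemma trajectory_y_lt_half t : Y 0 < 1 / 2 -> Y t < 1 / 2.
Proof.
rewrite -subr_gt0 => Y0; rewrite -subr_gt0.
have d (s : R) : is_derive s 1 (cst (1 / 2) - Y) (- (Y s * growth (Y s) (X s) (Z s))).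
  by have ? := dY s; apply: is_derive_eq; rewrite sub0r field_vE.
apply: (linear_growth_gt0 (K := 32) d _ (s := 0)) => // s.
by have [? ? ?] := XYZ_bounds s; have [? ? ?] := XYZ_norm s; exact: half_growth.
Qed.

Lemma trajectory_z_lt_half t : 1 / 2 < X 0 + Y 0 -> 1 / 2 < X t + Y t.
Proof.
have zE s : 1 / 2 - Z s = X s + Y s - 1 / 2 by rewrite /Z; field.
rewrite -subr_gt0 => Z0; rewrite -subr_gt0.
have d (s : R) : is_derive s 1 (X + Y - cst (1 / 2)) (- (Z s * growth (Z s) (X s) (Y s))).
  have ? := dX s; have ? := dY s; apply: is_derive_eq.
  by rewrite subr0 -field_uvE opprK.
apply: (linear_growth_gt0 (K := 32) d _ (s := 0)) => // s.
rewrite -[(X + Y - cst (1 / 2)) s]/(X s + Y s - 1 / 2) -zE.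
by have [? ? ?] := XYZ_bounds s; have [? ? ?] := XYZ_norm s; exact: half_growth.
Qed.

Lemma trajectory_x_gt0 t : 0 < X 0 -> 0 < X t.
Proof.
move=> X0; apply: (linear_growth_gt0 (K := 48) dX _ (s := 0)) => // s.
rewrite field_uE normrM mulrC ler_wpM2r //.
by have [x1 y1 z1] := XYZ_norm s; have [] := growth_le x1 y1 z1.
Qed.

Lemma trajectory_diagonal t : X 0 = Y 0 -> Y t = X t.
Proof.
move=> XY0; apply/esym/eqP; rewrite -subr_eq0; apply/eqP.
have d (s : R) : is_derive s 1 (X - Y) (field_u (X s) (Y s) - field_v (X s) (Y s)).
  by have ? := dX s; have ? := dY s; exact: is_deriveB.
apply: (linear_growth_eq0 (K := 50) d _ (s := 0)); last by rewrite !fctE XY0 subrr.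
move=> s; rewrite -[(X - Y) s]/(X s - Y s).
(* The field is symmetric under exchanging x and y, so the difference is divisible by X - Y; the
   cofactor is bounded by 50 on the triangle. *)
have -> : field_u (X s) (Y s) - field_v (X s) (Y s) =
  (2 * (1 - 3 * (X s + Y s) + 2 * (X s ^+ 2 + X s * Y s + Y s ^+ 2))
   + 24 * (X s * Y s * Z s)) * (X s - Y s).
  by rewrite /field_u /field_v /Z; ring.
rewrite normrM ler_wpM2r //.
have [/andP[x0 x1] /andP[y0 y1] /andP[z0 z1]] := XYZ_bounds s.
have xy0 : 0 <= X s * Y s by exact: mulr_ge0.
have xy1 : X s * Y s <= 1 by exact: mulr_ile1.
have xyz0 : 0 <= X s * Y s * Z s by exact: mulr_ge0.
have xyz1 : X s * Y s * Z s <= 1 by exact: mulr_ile1.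
have xx0 := sqr_ge0 (X s); have yy0 := sqr_ge0 (Y s).
have xx1 : X s ^+ 2 <= 1 by exact: exprn_ile1.
have yy1 : Y s ^+ 2 <= 1 by exact: exprn_ile1.
by rewrite ler_norml; apply/andP; split; lra.
Qed.

(** * The trajectory of (1/5, 1/5) *)

Section Diagonal.
Hypothesis (X0 : X 0 = 1 / 5) (Y0 : Y 0 = 1 / 5).

Let YX t : Y t = X t.
Proof. by apply: trajectory_diagonal; rewrite X0 Y0. Qed.

Let dXdiag (t : R) : is_derive t 1 X
  (2 * X t * (1 - 2 * X t) * (1 - 3 * X t) * (1 - 4 * X t)).
Proof.
by have ? := dX t; apply: is_derive_eq; rewrite YX /field_u; ring.
Qed.

Let X_gt0 t : 0 < X t.
Proof. by apply: trajectory_x_gt0; rewrite X0; lra. Qed.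

(* [x = y = 1/4] is a Kaehler-Einstein metric, hence a rest point. *)
Let X_lt_quarter t : X t < 1 / 4.
Proof.
rewrite -subr_gt0.
have d (s : R) : is_derive s 1 (cst (1 / 4) - X)
    (- (2 * X s * (1 - 2 * X s) * (1 - 3 * X s) * (1 - 4 * X s))).
  by have ? := dXdiag s; apply: is_derive_eq; rewrite sub0r.
apply: (linear_growth_gt0 (K := 16) d _ (s := 0)); last by rewrite !fctE X0; lra.
move=> s; rewrite -[(cst (1 / 4) - X) s]/(1 / 4 - X s).
have -> : - (2 * X s * (1 - 2 * X s) * (1 - 3 * X s) * (1 - 4 * X s)) =
  - (8 * (X s * ((1 - 2 * X s) * (1 - 3 * X s)))) * (1 / 4 - X s) by field.
rewrite normrM ler_wpM2r // normrN normrM ger0_norm //.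
(* The factors bound X by 1, |1 - 2X| by 1 and |1 - 3X| by 2. *)
rewrite (_ : 16 = 8 * (1 * (1 * 2))); last by ring.
have [x01 y01 _] := XYZ_bounds s; move: y01; rewrite YX => _.
have := XYT s; rewrite /triangle /= YX => -[x0 [_ x1]].
by rewrite ler_pM2l // !normrM !ler_pM ?mulr_ge0 //; rewrite ler_norml; apply/andP; split; lra.
Qed.

Lemma diagonal_ric_scal_near0 d : (0 < d)%N -> \forall t \near (0 : R), ric_scal d (X t, Y t).
Proof.
move=> d0; have : \forall t \near (0 : R), 1 / 8 < X t.
  have /cvgr_gt := @is_derive_continuous _ _ _ dX (0 : R); apply.
  by rewrite X0; lra.
apply: filterS => t Xt; have := X_lt_quarter t; have := X_gt0 t => ? ?.
rewrite YX; apply: ric_scal_pos => //; nra.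
Qed.

(** X is nondecreasing, so it gets smaller backwards in time. The level 1/20 is below the threshold
    1/18 of [not_ric_scal_diagonal], and by continuity X stays below it near -100. *)
Lemma diagonal_not_ric_scal_near d : (1 <= d <= 6)%N ->
  \forall t \near (-100 : R), ~ ric_scal d (X t, Y t).
Proof.
move=> d16.
have dX0 t : 0 <= 2 * X t * (1 - 2 * X t) * (1 - 3 * X t) * (1 - 4 * X t).
  by have := X_lt_quarter t; have := X_gt0 t => ? ?; rewrite !mulr_ge0 //; lra.
have X_le s t : s <= t -> X s <= X t by move=> st; apply: (is_derive_ndecr dXdiag).
have X100 : X (-100) < 1 / 20.
  (* While X >= 1/20 the speed is at least 1/400, so that X would have to increase by
     1/4 > 1/5 in 100 units of time. *)
  rewrite ltNge; apply/negP => X100.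
  pose W : R -> R := X - (1 / 400) \*: id.
  have WE s : W s = X s - 1 / 400 * s by [].
  have dW (s : R) : is_derive s 1 W
      (2 * X s * (1 - 2 * X s) * (1 - 3 * X s) * (1 - 4 * X s) - 1 / 400).
    by have ? := dXdiag s; apply: is_derive_eq; rewrite /GRing.scale /= mulr1.
  have : W (-100) <= W 0.
    apply: (is_derive_ndecr dW); first lra.
    move=> t /andP[t100 t0]; have xt : 1 / 20 <= X t by rewrite (le_trans X100) ?X_le.
    have xt' : X t <= 1 / 5 by rewrite -X0 X_le.
    (* For X in [1/20, 1/5] the last three factors of the speed are at least 1/2, 1/4 and 1/5. *)
    rewrite subr_ge0 (_ : 1 / 400 = 2 * (1 / 20) * (1 / 2) * (1 / 4) * (1 / 5)); last by field.
    by rewrite !ler_pM ?mulr_ge0 //; lra.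
  by rewrite !WE X0; lra.
have : \forall t \near (-100 : R), X t < 1 / 20.
  by have /cvgr_lt := @is_derive_continuous _ _ _ dX (-100 : R); apply.
apply: filterS => t Xt; rewrite YX; apply: not_ric_scal_diagonal => //; lra.
Qed.

End Diagonal.
End Trajectory.

Theorem theorem1p2 (R : realType) :
  (forall d : nat, (1 <= d <= 6)%N -> exists g : R * R, ric_scal d g) /\
  (exists phi : R -> R * R -> R * R, is_projected_ricci_flow phi) /\
  (forall phi : R -> R * R -> R * R, is_projected_ricci_flow phi ->
   forall d : nat, (1 <= d <= 6)%N ->
     (exists (g : R * R) (tstar : R),
        ric_scal d g /\
        (\forall t \near (0 : R), ric_scal d (phi t g)) /\
        (\forall t \near tstar, ~ ric_scal d (phi t g))) /\
     (exists A : set (R * R),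
        A !=set0 /\ open A /\ connected A /\ A `<` ric_scal d /\
        (forall g : R * R, A g -> forall t : R, A (phi t g)))).
Proof.
(* Here z = 3/5 < 6/5, so Ric > 0, yet z > 1/2. The point thus shows non-emptiness, starts the
   trajectory of (a), and lies outside the medial triangle, which makes the inclusion in (b)
   proper. *)
have base d : (0 < d)%N -> ric_scal d (1 / 5, 1 / 5 : R).
  by move=> d0; apply: ric_scal_pos => //; lra.
split; first by move=> d /andP[d0 _]; exists (1 / 5, 1 / 5); exact: base.
split; first exact: projected_ricci_flow_exists.
move=> phi phiP d /[dup] d16 /andP[d0 _]; split.
  exists (1 / 5, 1 / 5), (-100); split; first exact: base.
  have gT : triangle (1 / 5 : R, 1 / 5 : R) by split; [|split] => /=; lra.
  have [phi0 phid] := phiP _ gT.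
  pose X t := (phi t (1 / 5, 1 / 5)).1; pose Y t := (phi t (1 / 5, 1 / 5)).2.
  have phiE t : phi t (1 / 5, 1 / 5) = (X t, Y t) by rewrite -surjective_pairing.
  have XYT t : triangle (X t, Y t) by rewrite -phiE; have [] := phid t.
  have dX (t : R) : is_derive t 1 X (field_u (X t) (Y t)) by have [_ []] := phid t.
  have dY (t : R) : is_derive t 1 Y (field_v (X t) (Y t)) by have [_ []] := phid t.
  have X0 : X 0 = 1 / 5 by rewrite /X phi0.
  have Y0 : Y 0 = 1 / 5 by rewrite /Y phi0.
  split.
    have := diagonal_ric_scal_near0 XYT dX dY X0 Y0 d0.
    by apply: filterS => t; rewrite -phiE.
  have := diagonal_not_ric_scal_near XYT dX dY X0 Y0 d16.
  by apply: filterS => t; rewrite -phiE.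
exists (@medial_triangle R); split.
  by exists (2 / 5, 2 / 5); split; [|split] => /=; lra.
split; first exact: medial_triangle_open.
split; first exact: medial_triangle_connected.
split.
  rewrite properEneq; split; last exact: medial_triangle_ric_scal.
  apply/eqP => E; have := base d d0; rewrite -E => -[_ [_]] /=; lra.
move=> g gM.
have gT : triangle g by case: gM => ? [? ?]; split; [|split] => /=; lra.
have [phi0 phid] := phiP _ gT => t.
pose X s := (phi s g).1; pose Y s := (phi s g).2.
have XYT s : triangle (X s, Y s) by rewrite -surjective_pairing; have [] := phid s.
have dX (s : R) : is_derive s 1 X (field_u (X s) (Y s)) by have [_ []] := phid s.
have dY (s : R) : is_derive s 1 Y (field_v (X s) (Y s)) by have [_ []] := phid s.
case: gM => g1 [g2 g12].
split; first by apply: (trajectory_x_lt_half XYT dX); rewrite /X phi0.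
split; first by apply: (trajectory_y_lt_half XYT dY); rewrite /Y phi0.
by apply: (trajectory_z_lt_half XYT dX dY); rewrite /X /Y phi0.
Qed.
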